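(* Let $\alpha$ be a Pisot number of degree $d$ with minimal polynomial $P(x)=x^d-a_1x^{d-1}-a_2x^{d-2}-\dots-a_{d-1}x-a_d$, where $a_i\in\mathbb Z$. Suppose that $\sum_{i=1}^d a_i$ is even. Then $$L(\alpha)\le \frac{\sum_{i=1}^d |a_i|}{2\sum_{i=1}^d |a_i|+2}.$$
   Context: A Pisot number is a real algebraic integer $\alpha>1$ all of whose other conjugates lie strictly inside the unit disc $\{z\in\mathbb C:|z|<1\}$. For real $x$, $\|x\|$ denotes the distance from $x$ to the nearest integer. For a Pisot number $\alpha$, $L(\alpha):=\sup_{\xi\in\mathbb R}\liminf_{n\to\infty}\|\xi\alpha^n\|$; equivalently, $L(\alpha)$ is the supremum of the numbers $L$ such that for some $\xi\in\mathbb R$ all limit points of the sequence of fractional parts $\{\xi\alpha^n\}$ lie in $[L,1-L]$. *)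

(* Defs.v *)
From HB Require Import structures.
From mathcomp Require Import all_boot all_order all_algebra.
From mathcomp Require Import complex.
From mathcomp Require Import all_classical all_reals all_analysis.

Set Implicit Arguments.
Unset Strict Implicit.
Unset Printing Implicit Defensive.

Import Order.TTheory GRing.Theory Num.Theory.

Local Open Scope classical_set_scope.
Local Open Scope ring_scope.

Definition is_minpoly (R : realType) (x : R) (p : {poly rat}) : Prop :=
  [/\ p \is monic,
      root (map_poly ratr p) x &
      forall q : {poly rat}, root (map_poly ratr q) x -> p %| q].

Definition conjugate_of (R : realType) (x : R) (z : R[i]) : Prop :=
  exists2 p : {poly rat}, is_minpoly x p & root (map_poly ratr p) z.

Definition pisot (R : realType) (alpha : R) : Prop :=
  [/\ 1 < alpha,
      integralOver (intr : int -> R) alpha &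
      forall z : R[i],
        conjugate_of alpha z -> z != (alpha%:C)%C -> `|z| < 1].

Definition dist_int (R : realType) (x : R) : R :=
  inf [set `|x - m%:~R| | m in [set: int]].

(* Valued in the extended reals so that the supremum and the lower limit are
   unconditionally the mathematical ones; the value always lies in [0, 1/2]. *)
Definition pisotL (R : realType) (alpha : R) : \bar R :=
  ereal_sup (range (fun xi : R =>
    limn_einf (fun n : nat => (dist_int (xi * alpha ^+ n))%:E))).

(* 'X^d - a_1 'X^(d-1) - ... - a_d; only the values a 1, ..., a d matter. *)
Definition recurrence_poly (d : nat) (a : nat -> int) : {poly int} :=
  'X^d - \sum_(1 <= i < d.+1) a i *: 'X^(d - i).

(* Main.v *)
(** The iterates [xi * alpha ^+ k] satisfy the linear recurrence with
    coefficients [a i].  If they all stayed within less than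
    [1 / (2 * S + 2)] of half-integers, where [S] is the sum of the
    [`|a i|], the recurrence, applied to these half-integers, would be violated
    by less than [1 / 2].  The violation is however half an odd integer,
    because the sum of the [a i] is even.  Hence some iterate among any [d + 1]
    consecutive ones is at distance at most [S / (2 * S + 2)]
    from an integer. *)

Require Import Defs.
From mathcomp Require Import all_boot all_order all_algebra.
From mathcomp Require Import complex.
From mathcomp Require Import all_classical all_reals all_analysis.
From mathcomp Require Import zify ring lra.

Import Order.TTheory GRing.Theory Num.Theory.

Local Open Scope ring_scope.

Lemma dist_int_le (R : realType) (x : R) (m : int) :
  dist_int x <= `|x - m%:~R|.
Proof.
apply: ge_inf; last by exists m.
by exists 0 => _ [k _ <-].
Qed.

(** Both [Num.floor x] and its successor lie farther than [c] from [x], which confines [x] to a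
    window of radius [2^-1 - c] around their midpoint. *)
Lemma near_half_integer (R : realType) (x c : R) : c < dist_int x ->
  exists m : int, `|x - m%:~R - 2^-1| < 2^-1 - c.
Proof.
move=> hc; exists (Num.floor x).
have hl := lt_le_trans hc (dist_int_le R x (Num.floor x)).
have hr := lt_le_trans hc (dist_int_le R x (Num.floor x + 1)).
rewrite ger0_norm ?subr_ge0 ?floor_le// in hl.
rewrite ltr0_norm ?subr_lt0 ?floorD1_gt// in hr.
rewrite intrD in hr.
by rewrite ltr_norml; apply/andP; split; lra.
Qed.

Lemma normr_int_sub_half_ge (R : realType) (m : int) :
  2^-1 <= `|m%:~R - 2^-1| :> R.
Proof.
have [m1|m0] := leP 1 m.
  have : (1 : R) <= m%:~R by rewrite -[1]/(1%:~R) ler_int.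
  by move=> ?; rewrite ger0_norm; lra.
have : m%:~R <= (0 : R) by rewrite -[0]/(0%:~R) ler_int; lia.
by move=> ?; rewrite ler0_norm; lra.
Qed.

Lemma recurrence_poly_root (R : realType) (alpha : R) (d : nat)
    (a : nat -> int) :
  root (map_poly ratr (map_poly intr (recurrence_poly d a))) alpha ->
  alpha ^+ d = \sum_(1 <= i < d.+1) (a i)%:~R * alpha ^+ (d - i).
Proof.
rewrite -map_poly_comp (eq_map_poly (g := intr)); last first.
  by move=> z /=; rewrite ratr_int.
rewrite /root /recurrence_poly rmorphB rmorph_sum /= map_polyXn !hornerE.
rewrite subr_eq0 => /eqP ->; rewrite horner_sum.
by apply: eq_bigr => i _; rewrite map_polyZ map_polyXn !hornerE.
Qed.

Lemma exists_dist_int_le (R : realType) (alpha xi : R) (d : nat)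
    (a : nat -> int) (n : nat) (S := \sum_(1 <= i < d.+1) `|a i|) :
  alpha ^+ d = \sum_(1 <= i < d.+1) (a i)%:~R * alpha ^+ (d - i) ->
  (2 %| \sum_(1 <= i < d.+1) a i)%Z ->
  exists2 k, (n <= k)%N &
    dist_int (xi * alpha ^+ k) <= S%:~R / (2 * S%:~R + 2).
Proof.
move=> halpha /dvdzP[q hq]; apply: contrapT => hfar.
set c : R := S%:~R / (2 * S%:~R + 2).
have S0 : (0 : R) <= S%:~R by rewrite ler0z sumr_ge0.
have near k : exists m : int,
    `|xi * alpha ^+ (n + k) - m%:~R - 2^-1| < 2^-1 - c.
  apply: near_half_integer; rewrite ltNge; apply/negP => hk.
  by apply: hfar; exists (n + k)%N; rewrite ?leq_addr.
have [m hm] := choice near.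
pose e k : R := xi * alpha ^+ (n + k) - (m k)%:~R - 2^-1.
(* Putting the half-integers [m k + 2^-1] into the recurrence leaves the defect [w - 2^-1]: the
   halves in the sum add up to the integer [q], by parity. The iterates themselves leave no defect,
   so only the errors [e] contribute. *)
pose w : int := \sum_(1 <= i < d.+1) a i * m (d - i)%N - m d + q.
have hw : w%:~R - 2^-1 = e d - \sum_(1 <= i < d.+1) (a i)%:~R * e (d - i)%N.
  have -> : e d = \sum_(1 <= i < d.+1)
      (a i)%:~R * (xi * alpha ^+ (n + (d - i))) - (m d)%:~R - 2^-1.
    rewrite /e exprD halpha mulr_sumr mulr_sumr; congr (_ - _ - _).
    by apply: eq_bigr => i _; rewrite exprD; ring.
  have -> : \sum_(1 <= i < d.+1) (a i)%:~R * e (d - i)%N =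
      \sum_(1 <= i < d.+1) (a i)%:~R * (xi * alpha ^+ (n + (d - i)))
      - \sum_(1 <= i < d.+1) (a i)%:~R * (m (d - i)%N)%:~R
      - (\sum_(1 <= i < d.+1) (a i)%:~R) * 2^-1.
    rewrite mulr_suml -!sumrB; apply: eq_bigr => i _.
    by rewrite /e; ring.
  have -> : \sum_(1 <= i < d.+1) (a i)%:~R = q%:~R * 2 :> R.
    by rewrite -rmorph_sum hq rmorphM.
  rewrite /w intrD intrB rmorph_sum /=.
  under eq_bigr do rewrite intrM.
  by field.
have := normr_int_sub_half_ge R w.
rewrite hw leNgt => /negP; apply.
have le_sum : `|\sum_(1 <= i < d.+1) (a i)%:~R * e (d - i)%N|
    <= S%:~R * (2^-1 - c).
  rewrite /S rmorph_sum mulr_suml.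
  apply: le_trans (ler_norm_sum _ _ _) _; apply: ler_sum => i _.
  by rewrite normrM -intr_norm ler_wpM2l ?ler0z//; exact/ltW/hm.
apply: le_lt_trans (ler_normB _ _) _.
(* This balance determines [c]: [2^-1 - c] is [1 / (2 * S + 2)]. Strictness comes from the term
   [e d] alone, so [S = 0] is covered. *)
have -> : 2^-1 = (2^-1 - c) + S%:~R * (2^-1 - c).
  by rewrite /c; field; lra.
exact: ltr_leD (hm d) le_sum.
Qed.

Theorem theorem1 (R : realType) (alpha : R) (d : nat) (a : nat -> int)
    (halpha : pisot alpha)
    (hmin : is_minpoly alpha (map_poly intr (recurrence_poly d a)))
    (heven : (2 %| \sum_(1 <= i < d.+1) a i)%Z) :
  (pisotL alpha <=
   ((\sum_(1 <= i < d.+1) `|a i|)%:~R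
    / (2 * (\sum_(1 <= i < d.+1) `|a i|)%:~R + 2))%:E)%E.
Proof.
case: hmin => _ /recurrence_poly_root halg _.
apply: ge_ereal_sup => _ [xi _ <-].
(* The lower limit is the limit of the infima over the tails, and each tail contains an iterate
   [k >= n] obeying the bound. *)
rewrite limn_einf_lim; apply: lime_le; first exact: is_cvg_einfs.
apply: nearW => n.
have [k nk hk] := @exists_dist_int_le R alpha xi d a n halg heven.
apply: ge_ereal_inf; exists (dist_int (xi * alpha ^+ k))%:E; first by exists k.
by rewrite lee_fin.
Qed.
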